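(* For all positive integers $n$ and $m$, the $m$-th moment of the largest gap $d_{\max}$ between $n$ independent uniform random points on a circle of perimeter one is given by $$\mathbb{E}\left[\left(d_{\max}\right)^m\right] = \frac{(n-1)!}{(n+m-1)!}\sum_{\substack{r_1+2r_2+\cdots+m r_m=m\\ r_i\in\mathbb{N}_0}}\frac{m!}{r_1!\,1^{r_1}\,r_2!\,2^{r_2}\cdots r_m!\,m^{r_m}}\, H_{n,1}^{r_1}H_{n,2}^{r_2}\cdots H_{n,m}^{r_m}.$$
   Context: Let $X_1,\ldots,X_n$ be independent random variables, uniformly distributed on $[0,1]$, interpreted as locations of $n$ points on a circle with perimeter one. Let $d_1,\ldots,d_n$ be the arc-length distances between (cyclically) adjacent points: with order statistics $X_{(1)}\le\cdots\le X_{(n)}$, $d_i=X_{(i+1)}-X_{(i)}$ for $1\le i\le n-1$ and $d_n=1+X_{(1)}-X_{(n)}$ (so $d_1+\cdots+d_n=1$; the vector $(d_1,\ldots,d_n)$ is Dirichlet distributed with parameters $(1,\ldots,1)$). Put $d_{\max}=\max_{1\le i\le n} d_i$. For positive integers $n,r$, $H_{n,r}=\sum_{j=1}^n 1/j^r$ is the $n$-th harmonic number of order $r$. $\mathbb{N}_0$ denotes the nonnegative integers; the sum runs over all tuples $(r_1,\ldots,r_m)\in\mathbb{N}_0^m$ with $r_1+2r_2+\cdots+mr_m=m$. *)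

(* Defs.v *)
From HB Require Import structures.
From mathcomp Require Import all_boot all_order all_algebra.
From mathcomp Require Import all_classical all_reals all_analysis.
Set Implicit Arguments.
Unset Strict Implicit.
Unset Printing Implicit Defensive.
Import Order.TTheory GRing.Theory Num.Theory.
Local Open Scope classical_set_scope.
Local Open Scope ring_scope.

(* Mutual independence: the product rule for every subfamily J. *)
Definition mutually_independent (d d' : measure_display)
    (T : measurableType d) (T' : measurableType d') (R : realType)
    (P : probability T R) (I : finType) (X : I -> {RV P >-> T'}) : Prop :=
  forall (J : {set I}) (A : I -> set T'),
    (forall i, measurable (A i)) ->
    (P (\bigcap_(i in [set` J]) (X i @^-1` A i))
     = \prod_(i in J) P (X i @^-1` A i))%E.

(* Laws are compared on measurable sets only: on other sets the values of
   a measure are unconstrained. *)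
Definition uniform01 (d : measure_display) (T : measurableType d)
    (R : realType) (P : probability T R) (Y : {RV P >-> R}) : Prop :=
  forall A : set R, measurable A ->
    distribution P Y A = uniform_prob (@ltr01 R) A.

(* Ranks start at 0: order_stat x k is X_(k+1). *)
Definition order_stat (R : realType) (n : nat) (x : 'I_n -> R) (k : nat) : R :=
  (sort <=%R (codom x))`_k.

(* The last index gives the arc through the point 0 = 1 of the circle. *)
Definition circle_gap (R : realType) (n : nat) (x : 'I_n -> R) (i : 'I_n) : R :=
  if (i.+1 < n)%N then order_stat x i.+1 - order_stat x i
  else 1 + order_stat x 0 - order_stat x n.-1.

(* For n > 0 at least one gap is nonnegative whatever x is, so the default
   value 0 does not affect the maximum. *)
Definition max_gap (R : realType) (n : nat) (x : 'I_n -> R) : R :=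
  \big[Num.max/0]_(i < n) circle_gap x i.

Definition harmonic_number (R : realType) (n r : nat) : R :=
  \sum_(1 <= j < n.+1) 1 / j%:R ^+ r.

(* Main.v *)
Require Import Defs.
From HB Require Import structures.
From mathcomp Require Import all_boot all_order all_algebra.
From mathcomp Require Import all_classical all_reals all_analysis.
From mathcomp Require Import measurable_realfun.
From mathcomp Require Import ring lra zify.
Set Implicit Arguments.
Unset Strict Implicit.
Unset Printing Implicit Defensive.
Import Order.TTheory GRing.Theory Num.Theory.
Import numFieldNormedType.Exports.
Local Open Scope ring_scope.

(** Let [D] be the largest gap between [n] uniform points.  Both sides of the
    formula are equal to
      [m! (n-1)! / (n+m-1)! * S n m],  where
      [S n m = sum_(1 <= k <= n) (-1)^(k-1) C(n,k) / k^m].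

    On the algebraic side, the sum over exponent tuples divided by [m!] is the
    coefficient of [z^m] in [exp (sum_i H_(n,i) z^i / i)], which is the product
    of the [1 / (1 - z/j)] for [1 <= j <= n]; so it is the complete homogeneous
    symmetric polynomial of degree [m] at [1, 1/2, ..., 1/n], and [S n m] is the
    partial fraction expansion of the same number.  The two are identified
    through the recursion of Newton, [m h_m = sum_(1 <= i <= m) H_(n,i) h_(m-i)],
    which holds for the coefficients of the exponential because they solve a
    linear differential equation ([cycle_index_series_newton]), and for [S] by
    induction on [n] ([alt_binom_sum_newton]).

    On the probabilistic side, [S n m] comes from the law of [D],
      [P (D > x) = sum_(1 <= k <= n) (-1)^(k-1) C(n,k) max(0, 1 - k x)^(n-1)]
    ([cdf_max_gap], [max_gap_tail]): in [E D^m = int m x^(m-1) P (D > x) dx]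
    the [k]-th term contributes a Beta integral, equal to
    [m! (n-1)! / (n+m-1)! / k^m] times its coefficient ([integral_tail_sum]).

    The law of [D] is computed without any joint density.  Cut the circle into
    [N] arcs of equal length.  By independence every assignment of the [n]
    points to the arcs has probability [N^-n] ([prob_grid_cell]), and an
    assignment determines every gap up to [1/N].  So [P (D <= x)] is squeezed
    between proportions of assignments whose cyclic gaps are at most [a], for
    integers [a] close to [x N]; the assignments that are not injective are a
    vanishing proportion.  The others are counted exactly: there are
    [(n-1)! N] times the coefficient of [X^N] in [(X + ... + X^a)^n] of them
    ([card_close_cyclic_injections]), and expanding
    [(X (1 - X^a) / (1 - X))^n] turns this coefficient into an alternating sum
    of binomials ([coef_step_poly_exp]), whose limit is the claimed law.

    A single point has the whole circle as its gap and is treated apart: for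
    [n = 1] the formula for the tail would be correct only with the convention
    [0^0 = 0]. *)

(** * The harmonic sum as an alternating binomial sum *)

Definition alt_binom_sum (R : realFieldType) (n m : nat) : R :=
  \sum_(k < n) (-1) ^+ k * 'C(n, k.+1)%:R / k.+1%:R ^+ m.

(** The recursion of complete homogeneous polynomials when the variable
    [1 / n.+1] is adjoined; it comes from
    [C(n, k) / k.+1 = C(n.+1, k.+1) / n.+1]. *)
Lemma alt_binom_sumS (R : realFieldType) n m :
  alt_binom_sum R n.+1 m.+1
  = alt_binom_sum R n m.+1 + alt_binom_sum R n.+1 m / n.+1%:R.
Proof.
have -> : alt_binom_sum R n m.+1
    = \sum_(k < n.+1) (-1) ^+ k * 'C(n, k.+1)%:R / k.+1%:R ^+ m.+1.
  by rewrite big_ord_recr /= bin_small // mulr0 mul0r addr0.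
rewrite [X in _ = _ + X / _]/alt_binom_sum mulr_suml -big_split /=.
apply: eq_bigr => k _; rewrite [in LHS]binS [in LHS]natrD mulrDr mulrDl; congr (_ + _).
have nz j : j.+1%:R != 0 :> R by rewrite pnatr_eq0.
have E : n.+1%:R * 'C(n, k)%:R = k.+1%:R * 'C(n.+1, k.+1)%:R :> R.
  by rewrite -!natrM mul_bin_diag.
have -> : 'C(n.+1, k.+1)%:R = n.+1%:R * 'C(n, k)%:R / k.+1%:R :> R.
  by rewrite E mulrAC divff // mul1r.
rewrite exprS; field.
by rewrite expf_neq0 ?nz // !(addrC 1) !natr1 !nz.
Qed.

Lemma alt_binom_sum0 (R : realFieldType) n : alt_binom_sum R n.+1 0 = 1.
Proof.
have := exprDn (1 : R) (-1) n.+1.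
rewrite subrr expr0n /= big_ord_recl /= bin0 !expr1n expr0 mulr1 mulr1n.
move/eqP; rewrite eq_sym addrC addr_eq0 => /eqP E.
apply: oppr_inj; rewrite -E -sumrN; apply: eq_bigr => k _.
rewrite expr0 divr1 /= expr1n mul1r /bump leq0n add1n.
by rewrite exprS -[RHS]mulr_natr -mulrA mulN1r.
Qed.

(** Newton's identity between complete homogeneous and power sums.  The
    defect [D n m] between the two sides satisfies
    [D n.+1 m = D n m + D n.+1 (m - 1) / n.+2], by [alt_binom_sumS] and a
    telescoping of the terms with powers of [1 / n.+2]; so it vanishes by a
    double induction. *)
Lemma alt_binom_sum_newton (R : realType) n m :
  m.+1%:R * alt_binom_sum R n.+1 m.+1 =
  \sum_(i < m.+1) harmonic_number R n.+1 i.+1 * alt_binom_sum R n.+1 (m - i).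
Proof.
elim: n m => [|n IHn] m.
  have S1 k : alt_binom_sum R 1 k = 1.
    by rewrite /alt_binom_sum big_ord1 expr0 binn mul1r expr1n divr1.
  rewrite S1 mulr1 (eq_bigr (fun=> 1)) ?sumr_const ?card_ord // => i _.
  by rewrite S1 mulr1 /harmonic_number big_nat1 expr1n divr1.
set y : R := n.+2%:R^-1.
have H r : harmonic_number R n.+2 r = harmonic_number R n.+1 r + y ^+ r.
  by rewrite /harmonic_number big_nat_recr //= div1r exprVn.
have S k : alt_binom_sum R n.+2 k.+1
    = alt_binom_sum R n.+1 k.+1 + y * alt_binom_sum R n.+2 k.
  by rewrite alt_binom_sumS mulrC.
elim: m => [|m IHm].
  rewrite big_ord1 subn0 alt_binom_sum0 mulr1 mul1r S H alt_binom_sum0 mulr1.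
  have := IHn 0; rewrite big_ord1 subn0 alt_binom_sum0 mulr1 mul1r => ->.
  by rewrite expr1.
have E1 : \sum_(i < m.+2) harmonic_number R n.+1 i.+1 * alt_binom_sum R n.+2 (m.+1 - i)
   = \sum_(i < m.+2) harmonic_number R n.+1 i.+1 * alt_binom_sum R n.+1 (m.+1 - i)
     + y * \sum_(i < m.+1) harmonic_number R n.+1 i.+1 * alt_binom_sum R n.+2 (m - i).
  rewrite big_ord_recr [X in _ = X + _]big_ord_recr /= subnn !alt_binom_sum0.
  rewrite mulr_sumr addrAC -big_split /=; congr (_ + _).
  apply: eq_bigr => i _; rewrite subSn -1?ltnS // S; ring.
have E2 : \sum_(i < m.+2) y ^+ i.+1 * alt_binom_sum R n.+2 (m.+1 - i)
   = y * alt_binom_sum R n.+2 m.+1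
     + y * \sum_(i < m.+1) y ^+ i.+1 * alt_binom_sum R n.+2 (m - i).
  rewrite big_ord_recl /= subn0 expr1; congr (_ + _); rewrite mulr_sumr.
  by apply: eq_bigr => i _; rewrite /bump leq0n add1n subSS exprS mulrA.
under eq_bigr do rewrite H mulrDl.
rewrite big_split /= E1 E2 -IHn.
move: IHm; under eq_bigr do rewrite H mulrDl.
rewrite big_split /= => IHm.
rewrite S.
have -> : m.+2%:R * (alt_binom_sum R n.+1 m.+2 + y * alt_binom_sum R n.+2 m.+1)
  = m.+2%:R * alt_binom_sum R n.+1 m.+2 + y * alt_binom_sum R n.+2 m.+1
    + y * (m.+1%:R * alt_binom_sum R n.+2 m.+1).
  rewrite -(natr1 m.+1); ring.
rewrite IHm; ring.
Qed.

(** Truncating the exponential series after the power [B] keeps all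
    computations inside polynomials; coefficients of degree at most [B] are the
    right ones as soon as the argument has no constant term. *)
Definition exp_trunc (R : realFieldType) (B : nat) (q : {poly R}) : {poly R} :=
  \sum_(k < B.+1) (k`!%:R)^-1 *: q ^+ k.


(** The differential equation of the exponential, up to the order of
    truncation: the error is the last term of the series, which is divisible by
    [X^B] because [q] is divisible by [X]. *)
Lemma deriv_exp_trunc (R : realFieldType) B (q : {poly R}) : 'X %| q ->
  exists W, (exp_trunc B q)^`() = q^`() * exp_trunc B q + 'X^B * W.
Proof.
move=> /dvdpP[u qE]; exists (- (q^`() * (B`!%:R^-1 *: u ^+ B))).
have -> : 'X^B * - (q^`() * (B`!%:R^-1 *: u ^+ B))
        = - (q^`() * (B`!%:R^-1 *: q ^+ B)).
  by rewrite {3}qE exprMn -!mul_polyC; ring.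
rewrite /exp_trunc [X in _ * X]big_ord_recr /= mulrDr addrK.
rewrite raddf_sum big_ord_recl /= expr0 alg_polyC derivC add0r mulr_sumr.
apply: eq_bigr => k _; rewrite derivZ deriv_exp /bump leq0n add1n /=.
rewrite factS natrM invfM -[X in _ *: X]scaler_nat scalerA.
by rewrite mulrAC mulVf ?pnatr_eq0 // mul1r -scalerAr.
Qed.

Lemma deriv_prod_exp_trunc (R : realFieldType) B (I : finType) (q : I -> {poly R}) :
    (forall i, 'X %| q i) ->
  exists W, (\prod_i exp_trunc B (q i))^`()
    = (\sum_i q i)^`() * \prod_i exp_trunc B (q i) + 'X^B * W.
Proof.
move=> Xq; elim/big_rec2: _ => [|i t s _ [W EW]].
  by exists 0; rewrite -polyC1 !derivC; ring.
have [V EV] := deriv_exp_trunc B (Xq i).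
exists (V * s + exp_trunc B (q i) * W).
by rewrite derivM derivD EW EV; ring.
Qed.

(** This is [exp (sum_i p_i X^i / i)] up to degree [B], written as a
    product over [i] so that distributing it produces the exponent tuples. *)
Definition cycle_index_series (R : realFieldType) (p : nat -> R) B : {poly R} :=
  \prod_(i < B) exp_trunc B ((p i.+1 / i.+1%:R) *: 'X^(i.+1)).

Lemma cycle_index_series0 (R : realFieldType) (p : nat -> R) B :
  (cycle_index_series p B)`_0 = 1.
Proof.
rewrite -horner_coef0 horner_prod big1 // => i _.
rewrite horner_sum big_ord_recl big1 /= => [|k _].
  by rewrite expr0 alg_polyC hornerC fact0 invr1 addr0.
by rewrite hornerZ horner_exp hornerZ hornerXn expr0n /= mulr0 expr0n /= mulr0.
Qed.

(** Comparing coefficients in [E' = (sum_i p_i X^(i-1)) E]. *)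
Lemma cycle_index_series_newton (R : realFieldType) (p : nat -> R) B k :
    (k < B)%N ->
  k.+1%:R * (cycle_index_series p B)`_k.+1 =
  \sum_(i < k.+1) p i.+1 * (cycle_index_series p B)`_(k - i).
Proof.
move=> kB.
have Xq (i : 'I_B) : 'X %| (p i.+1 / i.+1%:R) *: 'X^(i.+1).
  by rewrite -mul_polyC dvdp_mull // exprS dvdp_mulr.
have [W /(congr1 (fun r : {poly R} => r`_k))] := deriv_prod_exp_trunc B Xq.
rewrite -/(cycle_index_series p B) coef_deriv mulr_natl => ->.
rewrite coefD coefXnM kB addr0 coefM; apply: eq_bigr => i _; congr (_ * _).
have iB : (i < B)%N by apply: leq_ltn_trans kB; rewrite -ltnS.
rewrite coef_deriv coef_sum (bigD1 (Ordinal iB)) //= big1 => [|j jn].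
  by rewrite coefZ coefXn eqxx mulr1 addr0 -[LHS]mulr_natr divfK // pnatr_eq0.
rewrite coefZ coefXn eqSS.
have /negPf -> : (i : nat) != j by rewrite eq_sym.
by rewrite mulr0.
Qed.

(** Newton's recursion and the constant term determine the coefficients. *)
Lemma cycle_index_series_harmonic (R : realType) n B m : (m <= B)%N ->
  (cycle_index_series (harmonic_number R n.+1) B)`_m = alt_binom_sum R n.+1 m.
Proof.
elim/ltn_ind: m => -[|m] IH mB; first by rewrite cycle_index_series0 alt_binom_sum0.
have /mulfI : m.+1%:R != 0 :> R by rewrite pnatr_eq0.
apply; rewrite cycle_index_series_newton // alt_binom_sum_newton.
apply: eq_bigr => i _; rewrite IH //; lia.
Qed.

Lemma cycle_index_seriesE (R : realFieldType) (p : nat -> R) m :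
  (cycle_index_series p m)`_m =
  \sum_(r : {ffun 'I_m -> 'I_m.+1} | (\sum_(i < m) i.+1 * r i)%N == m)
    (1 / \prod_(i < m) ((r i)`!%:R * i.+1%:R ^+ r i) * \prod_(i < m) p i.+1 ^+ r i).
Proof.
rewrite /cycle_index_series /exp_trunc bigA_distr_bigA coef_sum.
rewrite [RHS]big_mkcond; apply: eq_bigr => r _.
have -> : \prod_(i < m) ((r i)`!%:R^-1 *: (p i.+1 / i.+1%:R *: 'X^(i.+1)) ^+ r i)
   = (\prod_(i < m) ((r i)`!%:R^-1 * (p i.+1 / i.+1%:R) ^+ r i))
     *: 'X^(\sum_(i < m) i.+1 * r i).
  rewrite -prodrXr -scaler_prod; apply: eq_bigr => i _.
  by rewrite exprZn scalerA exprM.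
rewrite coefZ coefXn eq_sym; case: eqP => _; last by rewrite mulr0.
rewrite mulr1 div1r -prodfV -big_split; apply: eq_bigr => i _ /=.
by rewrite expr_div_n invfM; ring.
Qed.

Lemma partition_sum_harmonic (R : realType) n m :
  \sum_(r : {ffun 'I_m -> 'I_m.+1} | (\sum_(i < m) i.+1 * r i)%N == m)
    (m`!%:R / \prod_(i < m) ((r i)`!%:R * i.+1%:R ^+ r i)
      * \prod_(i < m) harmonic_number R n.+1 i.+1 ^+ r i)
  = m`!%:R * alt_binom_sum R n.+1 m.
Proof.
rewrite -(@cycle_index_series_harmonic _ n m) // cycle_index_seriesE mulr_sumr.
by apply: eq_bigr => r _; rewrite div1r -mulrA.
Qed.

(** * Compositions with bounded parts *)

(** Generating polynomial of a single step of length between [1] and [a]. *)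
Definition step_poly (R : realFieldType) (a : nat) : {poly R} :=
  \sum_(i < a) 'X^(i.+1).

Lemma coef_step_poly (R : realFieldType) a k :
  (step_poly R a)`_k = (0 < k <= a)%N%:R.
Proof.
rewrite /step_poly coef_sum; case: k => [|k] /=.
  by rewrite big1 // => i _; rewrite coefXn.
case: ltnP => ka.
  rewrite (bigD1 (Ordinal ka)) //= coefXn eqxx big1 ?addr0 // => i ik.
  by rewrite coefXn eqSS eq_sym; move: ik; rewrite -val_eqE /= => /negPf ->.
rewrite big1 // => i _; rewrite coefXn eqSS.
by rewrite gtn_eqF // (leq_trans (ltn_ord i)).
Qed.

Lemma mul_step_poly (R : realFieldType) a :
  (1 - 'X) * step_poly R a = 'X * (1 - 'X^a).
Proof.
rewrite -(opprB 'X^a 1) subrX1 /step_poly.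
under eq_bigr do rewrite exprS.
by rewrite -mulr_sumr; ring.
Qed.

Definition binom_poly (R : realFieldType) (K n : nat) : {poly R} :=
  \poly_(k < K) 'C(k + n, n)%:R.

(** The Pascal rule, read on truncations of [(1 - X)^-(n.+1)]. *)
Lemma binom_polyS (R : realFieldType) K n :
  (1 - 'X) * binom_poly R K n.+1
  = binom_poly R K n - 'C(K + n, n.+1)%:R *: 'X^K.
Proof.
rewrite /binom_poly !poly_def; elim: K => [|K IH].
  by rewrite !big_ord0 bin_small // scale0r subr0 mulr0.
rewrite !big_ord_recr /= mulrDr IH addSnnS !addnS binS natrD exprS -!mul_polyC !rmorphD /=.
ring.
Qed.

Lemma binom_poly_inverse (R : realFieldType) K n :
  exists W, (1 - 'X) ^+ n.+1 * binom_poly R K n = 1 + 'X^K * W.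
Proof.
elim: n => [|n [W IH]].
  exists (- 1); rewrite expr1 /binom_poly poly_def.
  under eq_bigr do rewrite addn0 bin0 scale1r.
  by rewrite -opprB mulNr -subrX1; ring.
exists (W - (1 - 'X) ^+ n.+1 * 'C(K + n, n.+1)%:R%:P).
by rewrite exprSr -mulrA binom_polyS mulrBr IH -mul_polyC; ring.
Qed.

(** Extracts the coefficient from [X^n (1 - X^a)^n / (1 - X)^n], with
    [n.+2] in place of [n].  The truncated subtraction is harmless: when
    [n.+2 + j a] exceeds [N], the upper argument of the binomial is below the
    lower one, which is positive. *)
Lemma coef_step_poly_exp (R : realFieldType) (a n N : nat) :
  (step_poly R a ^+ n.+2)`_N =
  \sum_(j < n.+3) (-1) ^+ j * 'C(n.+2, j)%:R * 'C(N.-1 - j * a, n.+1)%:R.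
Proof.
pose V := binom_poly R N.+1 n.+1.
(* Modulo [X^(N.+1)], [V] is the inverse of [(1 - X)^(n.+2)]. *)
have [W EW] := binom_poly_inverse R N.+1 n.+1.
rewrite -[binom_poly R N.+1 n.+1]/(V) in EW.
have E : V * ('X^(n.+2) * (1 - 'X^a) ^+ n.+2)
    = step_poly R a ^+ n.+2 + 'X^(N.+1) * (W * step_poly R a ^+ n.+2).
  rewrite -exprMn -mul_step_poly exprMn mulrC mulrAC EW; ring.
have -> : (step_poly R a ^+ n.+2)`_N
    = (V * ('X^(n.+2) * (1 - 'X^a) ^+ n.+2))`_N.
  by rewrite E coefD coefXnM ltnSn addr0.
rewrite exprBn !mulr_sumr coef_sum; apply: eq_bigr => j _.
have -> : V * ('X^(n.+2) * ((-1) ^+ j * 1 ^+ (n.+2 - j) * 'X^a ^+ j *+ 'C(n.+2, j)))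
    = ((-1) ^+ j * 'C(n.+2, j)%:R) *: (V * 'X^(n.+2 + a * j)).
  rewrite -mulr_natr expr1n mulr1 -exprM exprD -mul_polyC rmorphM rmorphXn /=.
  by rewrite rmorphN1 rmorph_nat; ring.
rewrite coefZ; congr (_ * _); rewrite coefMXn coef_poly.
case: ltnP => h; first by rewrite bin_small //; lia.
rewrite ifT; last by lia.
by congr ('C(_, _)%:R); lia.
Qed.

(** * Counting subsets of a cycle with bounded gaps *)

(** All sequences of [n] positions reached from [c] by steps of length
    between [1] and [a]; the starting point is left out. *)
Fixpoint walks (a n c : nat) : seq (seq nat) :=
  if n is n'.+1 then [seq c + d.+1 :: s | d <- iota 0 a, s <- walks a n' (c + d.+1)]%N
  else [:: [::]].

Lemma mem_walks a n c s :
  (s \in walks a n c) = (size s == n) && path (fun x y => x < y <= x + a)%N c s.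
Proof.
elim: n c s => [|n IH] c s /=; first by rewrite inE; case: s.
apply/allpairsPdep/idP => [[d [t [+ + ->]]] /=|].
  rewrite mem_iota IH => da /andP[/eqP-> ->]; rewrite eqxx /= andbT; lia.
case: s => [|x t] //=; rewrite eqSS => /and3P[st xc pt].
have cx : (c + (x - c).-1.+1)%N = x by lia.
by exists (x - c).-1, t; rewrite cx IH st pt mem_iota; split=> //; lia.
Qed.

Lemma uniq_walks a n c : uniq (walks a n c).
Proof.
elim: n c => [|n IH] c //=; apply: allpairs_uniq_dep => //; first exact: iota_uniq.
move=> [d s] [d' s'] _ _ /= [e ->].
by have -> : d = d' by lia.
Qed.

Lemma sum_shift (R : realFieldType) (p G : nat -> R) k M :
    (forall t, (M <= t)%N -> G t = 0) ->
  \sum_(0 <= u < M) (if (u < k)%N then 0 else p (u - k)%N) * G u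
  = \sum_(0 <= t < M) p t * G (k + t)%N.
Proof.
move=> G0.
transitivity (\sum_(0 <= u < k + M) (if (u < k)%N then 0 else p (u - k)%N) * G u).
  rewrite [in RHS](@big_cat_nat _ _ _ M) //= ?leq_addl //.
  rewrite [X in _ = _ + X]big1_seq ?addr0 // => u.
  by rewrite mem_index_iota => /andP[_ /andP[Mu _]]; rewrite G0 ?mulr0.
rewrite (@big_cat_nat _ _ _ k) ?leq_addr //= big1_seq ?add0r; last first.
  by move=> u; rewrite mem_index_iota => /andP[_ /andP[_ uk]]; rewrite uk mul0r.
rewrite -{1}(add0n k) big_addn addKn; apply: eq_bigr => t _.
by rewrite addnK [(k + t)%N]addnC ifF // ltnNge leq_addl.
Qed.

(** The final position of a walk is its starting point plus a sum of [n]
    steps, and [step_poly R a ^+ n] is the generating polynomial of such sums.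
    The function [F] has bounded support only to make the sum over [t] finite. *)
Lemma sum_last_walks (R : realFieldType) a n c M (F : nat -> R) :
    (forall t, (M <= t)%N -> F t = 0) ->
  \sum_(s <- walks a n c) F (last c s)
  = \sum_(0 <= t < M) (step_poly R a ^+ n)`_t * F (c + t)%N.
Proof.
move=> F0; elim: n c => [|n IH] c.
  rewrite big_seq1 /= expr0; case: M F0 => [|M] F0; first by rewrite big_geq // F0.
  rewrite big_nat_recl // coef1 mul1r addn0 big1 ?addr0 // => i _.
  by rewrite coef1 mul0r.
rewrite /= big_allpairs_dep /=.
under eq_bigr do rewrite IH.
have F0' t : (M <= t)%N -> F (c + t)%N = 0.
  by move=> Mt; rewrite F0 // (leq_trans Mt) // leq_addl.
transitivity (\sum_(0 <= d < a) \sum_(0 <= u < M)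
    (if (u < d.+1)%N then 0 else (step_poly R a ^+ n)`_(u - d.+1)) * F (c + u)%N).
  rewrite -[in iota _ a](subn0 a); apply: eq_bigr => d _.
  rewrite (sum_shift (fun k => (step_poly R a ^+ n)`_k) d.+1 F0').
  by apply: eq_bigr => t _; rewrite addnA.
rewrite exchange_big /=; apply: eq_bigr => u _; rewrite -mulr_suml; congr (_ * _).
rewrite big_mkord exprS /step_poly mulr_suml coef_sum.
by apply: eq_bigr => d _; rewrite coefXnM.
Qed.

(** Cyclic condition on an increasing list *)
(** For an increasing list of elements of [0 .. N-1], seen on the cycle of
    length [N], this says that all cyclic gaps are at most [a]. *)
Definition close_cyclic (a N : nat) (s : seq nat) : bool :=
  if s is c :: s' then path (fun x y => y <= x + a)%N c s' && (N + c <= last c s' + a)%N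
  else true.

Definition elements (N : nat) (A : {set 'I_N}) : seq nat := map val (enum A).

Lemma elements_sorted N (A : {set 'I_N}) : sorted ltn (elements A).
Proof.
rewrite /elements sorted_map {1}/enum_mem -enumT; apply: sorted_filter.
  by move=> x y z /=; apply: ltn_trans.
by rewrite -sorted_map val_enum_ord iota_ltn_sorted.
Qed.

Lemma mem_elements N (A : {set 'I_N}) (i : 'I_N) : (val i \in elements A) = (i \in A).
Proof. by rewrite mem_map ?mem_enum //; apply: val_inj. Qed.

Lemma elements_inj N : injective (@elements N).
Proof. by move=> A B AB; apply/setP => i; rewrite -!mem_elements AB. Qed.

(** Increasing lists of [n.+1] positions below [N] with all cyclic gaps at
    most [a], given by their first element and the walk that follows. *)
Definition cyclic_walks (a n N : nat) : seq (seq nat) :=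
  [seq c :: s | c <- iota 0 N,
     s <- [seq s <- walks a n c | (last c s < N) && (N + c <= last c s + a)]]%N.

Lemma path_ltn_last c (s : seq nat) x : path ltn c s -> x \in c :: s -> (x <= last c s)%N.
Proof.
elim: s c x => [|y s IH] c x /=; first by rewrite inE => _ /eqP->.
move=> /andP[cy ys]; rewrite inE => /orP[/eqP->|]; last exact: IH.
by rewrite (leq_trans (ltnW cy)) // IH // mem_head.
Qed.

Lemma card_close_cyclic_sets a n N :
  #|[set A : {set 'I_N} | (#|A| == n.+1) && close_cyclic a N (elements A)]|
  = size (cyclic_walks a n N).
Proof.
rewrite cardE -(size_map (@elements N)); apply/perm_size/uniq_perm.
- by rewrite map_inj_uniq ?enum_uniq //; apply: elements_inj.
- apply: allpairs_uniq_dep; first exact: iota_uniq.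
    by move=> c _; rewrite filter_uniq // uniq_walks.
  by move=> [c s] [c' s'] _ _ /= [-> ->].
move=> l; apply/mapP/allpairsPdep => [[A]|[c [s []]]].
  rewrite mem_enum inE => /andP[/eqP cA cl ->].
  have sA : size (elements A) = n.+1 by rewrite size_map -cardE.
  have ltA x : x \in elements A -> (x < N)%N.
    by move=> /mapP[i _ ->]; apply: ltn_ord.
  case: (elements A) sA cl (elements_sorted A) ltA => [//|c s] /= [sn] /andP[pa cl] ps lt.
  exists c, s; rewrite mem_iota lt ?mem_head // mem_filter cl mem_walks sn eqxx.
  rewrite lt ?mem_last //=; split=> //.
  elim: s c pa ps {sn cl lt} => //= x s IH c /andP[-> px] /andP[-> xs] /=.
  exact: IH.
rewrite mem_iota mem_filter mem_walks => cN /andP[/andP[lN cl] /andP[/eqP sn pw]] ->.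
have [pa ps] : path (fun x y => y <= x + a)%N c s /\ path ltn c s.
  elim: s c pw {cN lN cl sn} => //= x s IH c /andP[/andP[-> ->]] /IH [-> ->] //.
have ltN x : x \in c :: s -> (x < N)%N.
  by move=> /(path_ltn_last ps) /leq_ltn_trans; apply.
have E : elements [set i : 'I_N | val i \in c :: s] = c :: s.
  apply: (@irr_sorted_eq _ ltn); [exact: ltn_trans|exact: ltnn|exact: elements_sorted|by []|].
  move=> x; apply/idP/idP => [/mapP[i + ->]|xs].
    by rewrite mem_enum finset.in_set.
  have := mem_elements [set i : 'I_N | val i \in c :: s] (Ordinal (ltN x xs)).
  by rewrite finset.in_set /= xs => ->.
exists [set i : 'I_N | val i \in c :: s]; last by rewrite E.
by rewrite mem_enum inE cardE -(size_map val) -/(elements _) E /= sn eqxx pa.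
Qed.

(** A walk of total length [t] can start at [N - t] places, and [N - t] is
    also the gap that closes the cycle.  The number of lists is therefore the
    coefficient of [X^N] in [(X A') A^n], where [A] is [step_poly R a], and
    [n.+1] times this polynomial is [X (A^(n.+1))']. *)
Lemma size_cyclic_walks (R : realFieldType) a n N :
  n.+1%:R * (size (cyclic_walks a n N))%:R = N%:R * (step_poly R a ^+ n.+1)`_N.
Proof.
pose F c t : R := ((t < N) && (N + c <= t + a))%N%:R.
have -> : (size (cyclic_walks a n N))%:R
   = \sum_(0 <= c < N) \sum_(s <- walks a n c) F c (last c s).
  rewrite /cyclic_walks size_allpairs_dep sumnE big_map /index_iota subn0 natr_sum.
  apply: eq_bigr => c _; rewrite size_filter -sum1_count natr_sum big_mkcond /=.
  by apply: eq_bigr => s _; rewrite /F; case: ifP.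
have F0 c t : (N <= t)%N -> F c t = 0 by move=> Nt; rewrite /F ltnNge Nt.
under eq_bigr do rewrite (sum_last_walks _ _ _ (F0 _)).
rewrite exchange_big /=.
transitivity (('X * (step_poly R a ^+ n.+1)^`())`_N); last first.
  by case: (N) => [|k]; rewrite coefXM /= ?mul0r // coef_deriv mulr_natl.
have -> : 'X * (step_poly R a ^+ n.+1)^`()
    = n.+1%:R *: (step_poly R a ^+ n * ('X * (step_poly R a)^`())).
  by rewrite deriv_exp scaler_nat /= mulrnAr; congr (_ *+ _); ring.
rewrite coefZ; congr (_ * _); rewrite coefM -(big_mkord xpredT
  (fun j => (step_poly R a ^+ n)`_j * ('X * (step_poly R a)^`())`_(N - j))).
rewrite big_nat_recr //= subnn coefXM mulr0 addr0.
apply: eq_big_nat => t /andP[_ tN]; rewrite -mulr_sumr; congr (_ * _).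
rewrite coefXM subn_eq0 leqNgt tN coef_deriv prednK ?subn_gt0 // coef_step_poly.
rewrite -subn_gt0 in tN; rewrite tN /=.
transitivity (\sum_(0 <= c < N) ((c < N - t)%N && (N <= t + a)%N)%:R : R).
  by apply: eq_big_nat => c /andP[_ cN]; rewrite /F; congr (_ %:R); lia.
rewrite leq_subLR; case: (N <= t + a)%N; last first.
  by rewrite big1 ?mul0rn // => c _; rewrite andbF.
under eq_bigr do rewrite andbT.
rewrite (@big_cat_nat _ _ _ (N - t)) ?leq_subr //=.
rewrite [X in _ + X]big1_seq ?addr0; last first.
  by move=> u; rewrite mem_index_iota => /andP[_ /andP[Mu _]]; rewrite ltnNge Mu.
rewrite (eq_big_nat _ _ (F2 := fun=> 1)); last by move=> c /andP[_ ->].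
by rewrite sumr_const_nat subn0.
Qed.

Lemma image_injective_ffuns n N (A : {set 'I_N}) : #|A| = n ->
  #|[set f : {ffun 'I_n -> 'I_N} | injectiveb f & f @: 'I_n == A]| = n`!.
Proof.
move=> cA; have := card_inj_ffuns_on 'I_n (mem A).
rewrite card_ord cA ffactnn => <-.
apply: eq_card => f; rewrite !inE andbC; case: (boolP (injectiveb f)) => [/injectiveP fi|];
  last by rewrite !andbF.
rewrite !andbT; apply/eqP/ffun_onP => [<- i|fA]; first exact: imset_f.
apply/eqP; rewrite eqEcard card_imset // card_ord cA leqnn andbT.
by apply/fintype.subsetP => _ /imsetP[i _ ->].
Qed.

(** Each admissible set is the image of [n.+1`!] injections. *)
Lemma card_close_cyclic_injections (R : realFieldType) a n N :
  #|[set f : {ffun 'I_n.+1 -> 'I_N} |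
      injectiveb f & close_cyclic a N (elements (f @: 'I_n.+1))]|%:R
  = n`!%:R * N%:R * (step_poly R a ^+ n.+1)`_N.
Proof.
rewrite -mulrA -size_cyclic_walks mulrA -natrM mulnC -factS -natrM; congr (_%:R).
rewrite -card_close_cyclic_sets -sum1_card.
rewrite (partition_big (fun f : {ffun 'I_n.+1 -> 'I_N} => f @: 'I_n.+1)
   [in [set A : {set 'I_N} | (#|A| == n.+1) && close_cyclic a N (elements A)]]) /=; last first.
  move=> f; rewrite !inE => /andP[/injectiveP fi ->].
  by rewrite card_imset // card_ord eqxx.
rewrite (eq_bigr (fun=> n.+1`!)) ?sum_nat_const 1?mulnC // => A.
rewrite inE => /andP[/eqP cA clA]; rewrite -(image_injective_ffuns cA) -sum1_card.
apply: eq_bigl => f; rewrite !inE -andbA; congr (_ && _).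
by case: eqP => [->|_]; rewrite ?clA ?andbF.
Qed.

(** * Order statistics and gaps *)

Local Open Scope classical_set_scope.
Local Open Scope ring_scope.

Lemma size_sort_codom (R : realType) n (x : 'I_n -> R) :
  size (sort <=%R (codom x)) = n.
Proof. by rewrite size_sort size_codom card_ord. Qed.

(** Turns a statement on a rank into one on the number of small
    coordinates, which is symmetric in the points. *)
Lemma order_stat_le (R : realType) n (x : 'I_n -> R) k (t : R) : (k < n)%N ->
  (order_stat x k <= t) = (k < #|[set i | (x i <= t)%R]%SET|)%N.
Proof.
move=> kn; have ss := sort_le_sorted (codom x).
have -> : #|[set i | (x i <= t)%R]%SET| = count (<= t) (sort <=%R (codom x)).
  have /permP -> : perm_eq (sort <=%R (codom x)) (codom x) by rewrite perm_sort.
  rewrite /codom /image_mem count_map -size_filter cardE /enum_mem.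
  rewrite -filter_predI; congr size; apply: eq_filter => i.
  by rewrite /= finset.in_set andbT.
case: ltnP => h; first exact: nth_count_le.
apply/negbTE; rewrite -ltNge; apply: nth_count_gt => //.
by rewrite h size_sort_codom.
Qed.

Lemma order_stat_homo (R : realType) n (x : 'I_n -> R) (h : R -> R) k :
    {homo h : u v / u <= v} -> (k < n)%N ->
  order_stat (h \o x) k = h (order_stat x k).
Proof.
move=> hh kn; rewrite /order_stat -(nth_map 0 0 h) ?size_sort_codom //.
have -> : codom (h \o x) = map h (codom x) by rewrite -map_comp.
congr nth.
have pe : perm_eq (map h (sort <=%R (codom x))) (map h (codom x)).
  by rewrite perm_map // perm_sort.
have -> : sort <=%R (map h (codom x)) = sort <=%R (map h (sort <=%R (codom x))).
  by apply/perm_sort_leP; rewrite perm_sym.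
apply: sort_le_id; rewrite sorted_map.
apply: sub_sorted (sort_le_sorted (codom x)).
exact: hh.
Qed.

Lemma max_gap_ge0 (R : realType) n (x : 'I_n -> R) : 0 <= max_gap x.
Proof. exact: bigmax_ge_id. Qed.

Lemma max_gap_leP (R : realType) n (x : 'I_n -> R) (t : R) : 0 <= t ->
  reflect (forall i, circle_gap x i <= t) (max_gap x <= t).
Proof.
move=> t0; apply: (iffP (bigmax_leP _ _ _ _)) => [[_ h] i|h]; first exact: h.
by split.
Qed.

Lemma order_stat_grid (R : realType) n N (f : {ffun 'I_n -> 'I_N}) k :
    injectiveb f ->
  order_stat (fun i => (f i)%:R / N%:R : R) k
  = (nth 0%N (elements (f @: 'I_n)) k)%:R / N%:R.
Proof.
move=> /injectiveP fi; rewrite /order_stat.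
pose h j : R := j%:R / N%:R.
have hh u v : (u <= v)%N -> h u <= h v.
  by move=> uv; rewrite ler_wpM2r ?invr_ge0 // ler_nat.
have -> : sort <=%R (codom (fun i => (f i)%:R / N%:R : R))
   = map h (elements (f @: 'I_n)).
  have -> : codom (fun i => (f i)%:R / N%:R : R) = map h (map val (codom f)).
    by rewrite /codom /image_mem -!map_comp; apply: eq_map.
  have pe : perm_eq (map val (codom f)) (elements (f @: 'I_n)).
    apply/perm_map/uniq_perm; rewrite ?enum_uniq //; first exact/injectiveP.
    move=> j; rewrite mem_enum.
    by apply/codomP/imsetP => [[i ->]|[i _ ->]]; exists i.
  have /perm_sort_leP -> := perm_map h pe.
  apply: sort_le_id; rewrite sorted_map.
  apply: sub_sorted (elements_sorted _) => u v /ltnW; exact: hh.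
case: (ltnP k (size (elements (f @: 'I_n)))) => ks; first by rewrite (nth_map 0%N).
by rewrite [nth 0%N _ _]nth_default // mul0r nth_default // size_map.
Qed.

(** A monotone rounding [h] acts on order statistics coordinatewise, so a
    rounding error of at most [e] on the points, always in the same direction,
    is also at most [e] on their differences. *)
Lemma circle_gap_sandwich (R : realType) n (x : 'I_n -> R) (h : R -> R) (e : R) :
    {homo h : u v / u <= v} -> (forall u, h u <= u <= h u + e) ->
  forall i, circle_gap (h \o x) i - e <= circle_gap x i <= circle_gap (h \o x) i + e.
Proof.
move=> hh he i; have n0 : (0 < n)%N := leq_ltn_trans (leq0n i) (ltn_ord i).
rewrite /circle_gap; case: ifP => ni; rewrite !order_stat_homo ?prednK //.
  by move: (he (order_stat x i.+1)) (he (order_stat x i)) => /andP[? ?] /andP[? ?]; lra.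
by move: (he (order_stat x 0)) (he (order_stat x n.-1)) => /andP[? ?] /andP[? ?]; lra.
Qed.

(** For distinct points of the grid, bounding gaps is the combinatorial
    condition counted above. *)
Lemma circle_gap_grid (R : realType) n N a (f : {ffun 'I_n.+1 -> 'I_N}) :
    injectiveb f ->
  (forall i, circle_gap (fun i => (f i)%:R / N%:R : R) i <= a%:R / N%:R)
  <-> close_cyclic a N (elements (f @: 'I_n.+1)).
Proof.
move=> fi; have N0 : (0 < N)%N := leq_ltn_trans (leq0n (f ord0)) (ltn_ord _).
have N0R : 0 < N%:R :> R by rewrite ltr0n.
have sz : size (elements (f @: 'I_n.+1)) = n.+1.
  by rewrite size_map -cardE card_imset ?card_ord //; apply/injectiveP.
rewrite /circle_gap; under eq_forall do rewrite !order_stat_grid //.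
case: (elements _) sz => [//|c s] /= [sn].
have P i : ((if (i.+1 < n.+1)%N then
     (nth 0%N s i)%:R / N%:R - (nth 0%N (c :: s) i)%:R / N%:R
   else 1 + c%:R / N%:R - (nth 0%N (c :: s) n)%:R / N%:R) <= a%:R / N%:R :> R) =
   if (i.+1 < n.+1)%N then (nth 0%N s i <= nth 0%N (c :: s) i + a)%N
   else (N + c <= last c s + a)%N.
  case: ifP => _.
    by rewrite -mulrBl ler_pM2r ?invr_gt0 // lerBlDl -natrD ler_nat.
  rewrite -[X in X + _ - _ <= _](mulfV (lt0r_neq0 N0R)) -mulrDl -mulrBl ler_pM2r ?invr_gt0 //.
  by rewrite lerBlDl -!natrD ler_nat -sn nth_last.
split=> [h|/andP[/(pathP 0%N) h cl] i]; last by rewrite P; case: ifP => // ni; rewrite h // sn.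
apply/andP; split; last by have := h ord_max; rewrite P /= ltnn.
apply/(pathP 0%N) => i; rewrite sn => ni.
by have := h (Ordinal (leqW ni)); rewrite P /= ltnS ni.
Qed.

(** * Discretisation of independent uniform points *)

Lemma uniform_prob_itvco (R : realType) (a b : R) : 0 <= a -> a < b -> b <= 1 ->
  uniform_prob (@ltr01 R) `[a, b[%classic = (b - a)%:E.
Proof.
move=> a0 ab b1; rewrite /uniform_prob integral_uniform_pdf.
rewrite setIidl; last first.
  by move=> u; rewrite /= !in_itv /= => /andP[au ub]; lra.
rewrite (eq_integral (cst 1%:E)); last first.
  move=> u; rewrite inE /= in_itv /= => /andP[au ub].
  by rewrite /uniform_pdf ifT ?subr0 ?invr1 //; lra.
by rewrite integral_cst //= mul1e lebesgue_measure_itv /= lte_fin ab EFinB.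
Qed.

Definition grid_cell (d : measure_display) (T : measurableType d) (R : realType)
    (P : probability T R) (n N : nat) (X : 'I_n -> {RV P >-> R})
    (f : {ffun 'I_n -> 'I_N}) : set T :=
  \bigcap_(i in [set` [set: 'I_n]%SET])
    (X i @^-1` `[(f i)%:R / N%:R, (f i).+1%:R / N%:R[%classic).

Lemma measurable_grid_cell (d : measure_display) (T : measurableType d) (R : realType)
    (P : probability T R) (n N : nat) (X : 'I_n -> {RV P >-> R})
    (f : {ffun 'I_n -> 'I_N}) : measurable (grid_cell X f).
Proof.
apply: fin_bigcap_measurable => [|i _]; first exact: finite_finset.
exact: measurable_funPTI.
Qed.

Lemma prob_grid_cell (d : measure_display) (T : measurableType d) (R : realType)
    (P : probability T R) (n N : nat) (X : 'I_n -> {RV P >-> R})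
    (f : {ffun 'I_n -> 'I_N}) :
  mutually_independent X -> (forall i, uniform01 (X i)) ->
  P (grid_cell X f) = (N%:R ^- n)%:E.
Proof.
move=> indep unif.
pose cell (i : 'I_n) : set R := `[(f i)%:R / N%:R, (f i).+1%:R / N%:R[%classic.
have cellE i : P (X i @^-1` cell i) = (N%:R^-1)%:E.
  have N0 : (0 < N)%N := leq_ltn_trans (leq0n (f i)) (ltn_ord _).
  have N0R : 0 < N%:R^-1 :> R by rewrite invr_gt0 ltr0n.
  have := unif i (cell i); rewrite /distribution /pushforward => ->; last exact: measurable_itv.
  rewrite uniform_prob_itvco.
  - by rewrite -mulrBl -natrB // subSnn mul1r.
  - by rewrite mulr_ge0 // ltW.
  - by rewrite ltr_pM2r // ltr_nat.
  - by rewrite ler_pdivrMr ?ltr0n // mul1r ler_nat.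
rewrite /grid_cell (indep [set: 'I_n]%SET cell) => [|i]; last exact: measurable_itv.
rewrite (eq_bigr _ (fun i _ => cellE i)).
by rewrite prodEFin prodr_const cardsT card_ord exprVn.
Qed.

Lemma floor_grid_cell (R : realType) (N : nat) (u : R) (k : nat) : (0 < N)%N ->
  k%:R / N%:R <= u < k.+1%:R / N%:R -> (Num.floor (u * N%:R))%:~R / N%:R = k%:R / N%:R :> R.
Proof.
move=> N0; have N0R : 0 < N%:R :> R by rewrite ltr0n.
rewrite ler_pdivrMr // ltr_pdivlMr // => ku; congr (_ / _).
by rewrite (@floor_def _ _ k) // intrD -pmulrn natr1.
Qed.

Lemma floor_grid_sandwich (R : realType) (N : nat) (u : R) : (0 < N)%N ->
  (Num.floor (u * N%:R))%:~R / N%:R <= u <= (Num.floor (u * N%:R))%:~R / N%:R + N%:R^-1.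
Proof.
move=> N0; have N0R : 0 < N%:R :> R by rewrite ltr0n.
rewrite ler_pdivrMr // floor_le /= -{2}[N%:R^-1]mul1r -mulrDl ler_pdivlMr //.
by have /andP[_ /ltW] := floor_itv (u * N%:R); rewrite intrD.
Qed.

(** On a grid cell the points round down to the fixed grid points [f i / N],
    by [floor_grid_cell]. *)
Lemma grid_cell_max_gap (d : measure_display) (T : measurableType d) (R : realType)
    (P : probability T R) (n N : nat) (X : 'I_n.+1 -> {RV P >-> R})
    (f : {ffun 'I_n.+1 -> 'I_N}) (w : T) : grid_cell X f w ->
  forall i, circle_gap (fun i => (f i)%:R / N%:R) i - N%:R^-1
    <= circle_gap (fun i => X i w) i
    <= circle_gap (fun i => (f i)%:R / N%:R) i + N%:R^-1.
Proof.
move=> fw; have N0 : (0 < N)%N := leq_ltn_trans (leq0n (f ord0)) (ltn_ord _).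
pose h (u : R) : R := (Num.floor (u * N%:R))%:~R / N%:R.
have -> : (fun i => (f i)%:R / N%:R) = h \o (fun i => X i w).
  apply/funext => i; rewrite /h /= (@floor_grid_cell _ N _ (f i)) //.
  by have := fw i; rewrite /= in_itv /=; apply; rewrite inE.
apply: circle_gap_sandwich => [u v uv|u]; last exact: floor_grid_sandwich.
by rewrite /h ler_wpM2r ?invr_ge0 // ler_int le_floor // ler_wpM2r.
Qed.

Lemma trivIset_grid_cell (d : measure_display) (T : measurableType d) (R : realType)
    (P : probability T R) (n N : nat) (X : 'I_n -> {RV P >-> R})
    (D : set {ffun 'I_n -> 'I_N}) : trivIset D (fun f => grid_cell X f).
Proof.
move=> f g _ _ [w [fw gw]]; apply/ffunP => i; apply: val_inj => /=.
have N0 : (0 < N)%N := leq_ltn_trans (leq0n (f i)) (ltn_ord _).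
have Ni0 : 0 < N%:R^-1 :> R by rewrite invr_gt0 ltr0n.
have iT : [set` [set: 'I_n]%SET] i by rewrite /= finset.in_setT.
have := gw i iT; have := fw i iT; rewrite /= !in_itv /=.
move=> /andP[f1 f2] /andP[g1 g2].
have := le_lt_trans f1 g2; have := le_lt_trans g1 f2.
by rewrite !ltr_pM2r // !ltr_nat; lia.
Qed.

(** Indexed by the list [enum S] so that sums over this index set are
    ordinary finite sums, by [fsbig_seq]. *)
Definition grid_event (d : measure_display) (T : measurableType d) (R : realType)
    (P : probability T R) (n N : nat) (X : 'I_n -> {RV P >-> R})
    (S : {set {ffun 'I_n -> 'I_N}}) : set T :=
  \bigcup_(f in [set` enum S]) grid_cell X f.

Lemma measurable_grid_event (d : measure_display) (T : measurableType d) (R : realType)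
    (P : probability T R) (n N : nat) (X : 'I_n -> {RV P >-> R})
    (S : {set {ffun 'I_n -> 'I_N}}) : measurable (grid_event X S).
Proof.
apply: fin_bigcup_measurable => [|f _]; first exact: finite_finset.
exact: measurable_grid_cell.
Qed.

Lemma prob_grid_event (d : measure_display) (T : measurableType d) (R : realType)
    (P : probability T R) (n N : nat) (X : 'I_n -> {RV P >-> R})
    (S : {set {ffun 'I_n -> 'I_N}}) :
  mutually_independent X -> (forall i, uniform01 (X i)) ->
  P (grid_event X S) = (#|S|%:R / N%:R ^+ n)%:E.
Proof.
move=> indep unif; rewrite /grid_event measure_fin_bigcup; first last.
- by move=> f _; apply: measurable_grid_cell.
- exact: trivIset_grid_cell.
- exact: finite_finset.
rewrite -fsbig_seq ?enum_uniq // big_enum /=.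
rewrite (eq_bigr _ (fun f _ => prob_grid_cell f indep unif)).
by rewrite sumEFin sumr_const mulr_natl.
Qed.

(** By [order_stat_le], an order statistic exceeds [t] unless some set of
    more than [k] coordinates lies below [t]: a finite union of finite
    intersections. *)
Lemma measurable_order_stat (d : measure_display) (T : measurableType d) (R : realType)
    (P : probability T R) (n k : nat) (X : 'I_n -> {RV P >-> R}) : (k < n)%N ->
  measurable_fun setT (fun w => order_stat (fun i => X i w) k).
Proof.
move=> kn; apply: (measurability _ (RGenOInfty.measurableE R)) => //.
move=> _ [_ [t ->] <-]; apply: measurableI => //.
have -> : (fun w => order_stat (fun i => X i w) k) @^-1` `]t, +oo[ = ~`
    \bigcup_(J in [set J : {set 'I_n} | (k < #|J|)%N])
      \bigcap_(i in [set` J]) (X i @^-1` `]-oo, t]).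
  apply/seteqP; split=> w /=; rewrite in_itv /= andbT ltNge order_stat_le //.
    move=> /negP h [J /= kJ JX]; apply: h; apply: leq_trans kJ _.
    apply/subset_leq_card/fintype.subsetP => i iJ.
    by have := JX i iJ; rewrite finset.in_set /= in_itv.
  move=> h; apply/negP => kJ; apply: h.
  exists [set i | (X i w <= t)%R]%SET => // i /=.
  by rewrite finset.in_set in_itv.
apply: measurableC; apply: fin_bigcup_measurable => [|J _]; first exact: finite_finset.
apply: fin_bigcap_measurable => [|i _]; first exact: finite_finset.
exact: measurable_funPTI.
Qed.

Lemma measurable_max_gap (d : measure_display) (T : measurableType d) (R : realType)
    (P : probability T R) (n : nat) (X : 'I_n -> {RV P >-> R}) :
  measurable_fun setT (fun w => max_gap (fun i => X i w)).
Proof.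
rewrite /max_gap; elim: (index_enum _) => [|i r IH].
  by under eq_fun do [rewrite big_nil]; exact: measurable_cst.
under eq_fun do rewrite big_cons; apply: measurable_maxr => //.
have n0 : (0 < n)%N := leq_ltn_trans (leq0n i) (ltn_ord i).
have mo k : (k < n)%N -> measurable_fun setT (fun w => order_stat (fun i => X i w) k).
  by move=> kn; apply: (measurable_order_stat X kn).
rewrite /circle_gap; case: (i.+1 < n)%N (@mo i.+1) => mo1; apply: measurable_funB.
- exact: mo1.
- exact: mo.
- by apply: measurable_funD => //; apply: mo.
- by apply: mo; rewrite prednK.
Qed.

Lemma measurable_max_gap_le (d : measure_display) (T : measurableType d) (R : realType)
    (P : probability T R) (n : nat) (X : 'I_n -> {RV P >-> R}) (x : R) :
  measurable [set w | max_gap (fun i => X i w) <= x].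
Proof.
have := measurable_max_gap X measurableT (measurable_itv `]-oo, x]).
by rewrite setTI.
Qed.

(** Injective assignments with gaps at most [a] force a largest gap of at
    most [(a + 1) / N]. *)
Lemma cdf_max_gap_ge (d : measure_display) (T : measurableType d) (R : realType)
    (P : probability T R) (n N a : nat) (X : 'I_n.+1 -> {RV P >-> R}) (x : R) :
  mutually_independent X -> (forall i, uniform01 (X i)) ->
  (0 < N)%N -> a.+1%:R <= x * N%:R ->
  ((n`!%:R * N%:R * (step_poly R a ^+ n.+1)`_N / N%:R ^+ n.+1)%:E <=
   P [set w | (max_gap (fun i => X i w) <= x)%R])%E.
Proof.
move=> indep unif N0 ax; have N0R : 0 < N%:R :> R by rewrite ltr0n.
have x0 : 0 <= x.
  by rewrite -(pmulr_lge0 _ N0R); apply: le_trans ax; rewrite ler0n.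
rewrite -card_close_cyclic_injections -(prob_grid_event _ indep unif).
apply: le_measure; rewrite ?inE.
- exact: measurable_grid_event.
- exact: measurable_max_gap_le.
move=> w [f /=]; rewrite mem_enum finset.in_set => /andP[fi cl] fw.
apply/max_gap_leP => // i; have /andP[_ h] := grid_cell_max_gap fw i.
apply: le_trans h _.
have /(circle_gap_grid R a fi) /(_ i) h := cl.
apply: (@le_trans _ _ (a%:R / N%:R + N%:R^-1)); first by rewrite lerD2r.
by rewrite -[X in _ + X]mul1r -mulrDl natr1 ler_pdivrMr.
Qed.

(** If the largest gap is at most [x], then either the points share a cell,
    or fall outside of the grid, both being counted by the second term, or
    their cells have gaps at most [x N + 1]. *)
Lemma cdf_max_gap_le (d : measure_display) (T : measurableType d) (R : realType)
    (P : probability T R) (n N a : nat) (X : 'I_n.+1 -> {RV P >-> R}) (x : R) :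
  mutually_independent X -> (forall i, uniform01 (X i)) ->
  (0 < N)%N -> 0 <= x -> x * N%:R + 1 <= a%:R ->
  (P [set w | (max_gap (fun i => X i w) <= x)%R] <=
   (n`!%:R * N%:R * (step_poly R a ^+ n.+1)`_N / N%:R ^+ n.+1
    + (1 - (N ^_ n.+1)%:R / N%:R ^+ n.+1))%:E)%E.
Proof.
move=> indep unif N0 x0 xa; have N0R : 0 < N%:R :> R by rewrite ltr0n.
(* The complement of the event of [I] absorbs the points outside of [0, 1[. *)
pose I := [set f : {ffun 'I_n.+1 -> 'I_N} | injectiveb f]%SET.
have cI : #|I| = (N ^_ n.+1)%N.
  by have := card_inj_ffuns 'I_n.+1 'I_N; rewrite !card_ord => <-; rewrite cardsE.
rewrite -card_close_cyclic_injections -cI EFinD EFinB.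
rewrite -!(prob_grid_event _ indep unif).
rewrite -probability_setC; last exact: measurable_grid_event.
apply: (@le_trans _ _ (P (grid_event X
    [set f : {ffun _ -> _} | injectiveb f & close_cyclic a N (elements (f @: 'I_n.+1))]%SET
  `|` ~` grid_event X I))); last apply: measureU2; first last.
- by apply: measurableC; apply: measurable_grid_event.
- exact: measurable_grid_event.
apply: le_measure; rewrite ?inE.
- exact: measurable_max_gap_le.
- by apply: measurableU; [|apply: measurableC]; apply: measurable_grid_event.
move=> w /= wx; case: (pselect (grid_event X I w)) => [|]; last by right.
move=> [f /=]; rewrite mem_enum finset.in_set => fi fw; left.
exists f => //=; rewrite mem_enum finset.in_set fi /=.
apply/(circle_gap_grid R a fi) => i.
have /andP[h _] := grid_cell_max_gap fw i.
have /(max_gap_leP _ x0) /(_ i) h' := wx.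
rewrite lerBlDr in h; apply: le_trans h _.
apply: (@le_trans _ _ (x + N%:R^-1)); first by rewrite lerD2r.
by rewrite ler_pdivlMr // mulrDl mulVf // lt0r_neq0.
Qed.

(** * The law of the largest gap *)

Definition pos_part (R : realType) (u : R) : R := Num.max 0 u.

Lemma pos_partE (R : realType) (u : R) : pos_part u = (u + `|u|) / 2.
Proof.
by rewrite /pos_part; case: leP => u0; [rewrite ger0_norm|rewrite ltr0_norm]; lra.
Qed.

Lemma continuous_pos_part (R : realType) : continuous (@pos_part R).
Proof.
move=> u; rewrite (_ : @pos_part R = fun u => (u + `|u|) / 2); last first.
  by apply/funext => v; rewrite pos_partE.
apply: cvgMl; apply: cvgD; first exact: cvg_id.
exact: norm_continuous.
Qed.

Lemma natrB_pos_part (R : realType) p q : (p - q)%:R = pos_part (p%:R - q%:R) :> R.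
Proof.
rewrite /pos_part; case: (leqP q p) => qp.
  by rewrite natrB // max_r // subr_ge0 ler_nat.
have /eqP -> : (p - q)%N == 0%N by rewrite subn_eq0 ltnW.
by rewrite max_l // subr_le0 ler_nat ltnW.
Qed.

(** Each factor [(N - q - i) / N] of the falling factorial tends to
    [1 - y], truncated at [0] like the subtraction of natural numbers. *)
Lemma ffact_ratio_cvg (R : realType) (q : nat -> nat) (y : R) k :
    (q N)%:R / N.+1%:R @[N --> \oo] --> y ->
  ((N.+1 - q N) ^_ k)%:R / N.+1%:R ^+ k @[N --> \oo] --> pos_part (1 - y) ^+ k.
Proof.
move=> qy.
have E N : ((N.+1 - q N) ^_ k)%:R / N.+1%:R ^+ k
    = \prod_(i < k) pos_part (1 - (q N)%:R / N.+1%:R - i%:R * harmonic N) :> R.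
  rewrite ffact_prod natr_prod -exprVn.
  have -> : N.+1%:R^-1 ^+ k = \prod_(i < k) N.+1%:R^-1 :> R.
    by rewrite prodr_const card_ord.
  rewrite -big_split /=.
  apply: eq_bigr => i _; have N0 : 0 < N.+1%:R :> R by rewrite ltr0n.
  rewrite -subnDA natrB_pos_part /pos_part maxr_pMl ?invr_ge0 ?ltW //.
  rewrite mul0r natrD; congr Num.max; rewrite /harmonic.
  by rewrite mulrBl mulrDl divff ?gt_eqF // opprD addrA.
under eq_fun do rewrite E.
have -> : pos_part (1 - y) ^+ k = \prod_(i < k) pos_part (1 - y).
  by rewrite prodr_const card_ord.
apply: cvg_big => [|i _]; first exact: mul_continuous.
apply: (@cvg_comp _ _ _ _ (@pos_part R)); last exact: continuous_pos_part.
rewrite -[1 - y]subr0 -(mulr0 i%:R); apply: cvgB.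
  by apply: cvgB => //; apply: cvg_cst.
by apply: cvgMr; exact: cvg_harmonic.
Qed.

(** The distribution function of the largest of [n.+2] gaps, on positive
    reals. *)
Definition spacing_cdf (R : realType) (n : nat) (x : R) : R :=
  \sum_(j < n.+3) (-1) ^+ j * 'C(n.+2, j)%:R * pos_part (1 - j%:R * x) ^+ n.+1.

Lemma step_poly_ratio_cvg (R : realType) n (a : nat -> nat) (x : R) :
    (a N)%:R / N.+1%:R @[N --> \oo] --> x ->
  n.+1`!%:R * N.+1%:R * (step_poly R (a N) ^+ n.+2)`_N.+1 / N.+1%:R ^+ n.+2
  @[N --> \oo] --> spacing_cdf n x.
Proof.
move=> ax.
have E N : n.+1`!%:R * N.+1%:R * (step_poly R (a N) ^+ n.+2)`_N.+1 / N.+1%:R ^+ n.+2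
   = \sum_(j < n.+3) (-1) ^+ j * 'C(n.+2, j)%:R
        * (((N.+1 - (1 + j * a N)) ^_ n.+1)%:R / N.+1%:R ^+ n.+1) :> R.
  rewrite coef_step_poly_exp /= mulr_sumr mulr_suml; apply: eq_bigr => j _.
  rewrite add1n subSS -bin_ffact natrM [in LHS]exprS.
  have N0 : N.+1%:R != 0 :> R by rewrite pnatr_eq0.
  by rewrite invfM -[RHS]mul1r -[X in _ = X * _](mulfV N0); ring.
under eq_fun do rewrite E.
apply: cvg_big => [|j _]; first exact: add_continuous.
apply: cvgMr; apply: ffact_ratio_cvg.
have -> : (fun N => (1 + j * a N)%N%:R / N.+1%:R)
   = (fun N => harmonic N + j%:R * ((a N)%:R / N.+1%:R)) :> (nat -> R).
  by apply/funext => N; rewrite natrD natrM mulrDl mul1r mulrA.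
rewrite -[j%:R * x]add0r; apply: cvgD; first exact: cvg_harmonic.
exact: cvgMr.
Qed.

Lemma close_to_ratio_cvg (R : realType) (a : nat -> nat) (x c : R) :
    (forall N, x * N.+1%:R - c <= (a N)%:R <= x * N.+1%:R + c) ->
  (a N)%:R / N.+1%:R @[N --> \oo] --> x.
Proof.
move=> xa; have ch : c * harmonic N @[N --> \oo] --> (0 : R).
  by rewrite -(mulr0 c); apply: cvgMr; exact: cvg_harmonic.
apply: (@squeeze_cvgr _ _ _ _ (fun N => x - c * harmonic N)
   (fun N => x + c * harmonic N)).
- apply: nearW => N; have N0 : 0 < N.+1%:R :> R by rewrite ltr0n.
  rewrite ler_pdivlMr // ler_pdivrMr // mulrBl mulrDl /harmonic !divfK ?gt_eqF //.
- by have := cvgB (cvg_cst x) ch; rewrite subr0; apply.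
- by have := cvgD (cvg_cst x) ch; rewrite addr0; apply.
Qed.

(** Both bounds by counts have the same limit when [a / N] tends to [x]. *)
Lemma cdf_max_gap (d : measure_display) (T : measurableType d) (R : realType)
    (P : probability T R) (n : nat) (X : 'I_n.+2 -> {RV P >-> R}) (x : R) :
  mutually_independent X -> (forall i, uniform01 (X i)) -> 0 < x ->
  P [set w | (max_gap (fun i => X i w) <= x)%R] = (spacing_cdf n x)%:E.
Proof.
move=> indep unif x0.
set A := [set w | _].
have Pfin : P A \is a fin_num.
  by apply: fin_num_measure; apply: measurable_max_gap_le.
rewrite -(fineK Pfin); congr EFin; set p := fine _.
have pE : P A = p%:E by rewrite fineK.
have xN (N : nat) : 0 <= x * N.+1%:R by rewrite mulr_ge0 // ltW.
apply/eqP; rewrite eq_le; apply/andP; split.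
(* Upper bound: this [a N] is at least [x N.+1 + 1]. *)
- pose a N := (Num.truncn (x * N.+1%:R)).+2.
  have ac : (a N)%:R / N.+1%:R @[N --> \oo] --> x.
    apply: (@close_to_ratio_cvg _ _ _ 2) => N.
    have /andP[] := truncn_itv (xN N).
    by rewrite /a -!natr1; lra.
  have c0 : (0%N)%:R / N.+1%:R @[N --> \oo] --> (0 : R).
    by under eq_fun do rewrite mul0r; exact: cvg_cst.
  have u1 := step_poly_ratio_cvg (n := n) ac.
  have u2 := ffact_ratio_cvg (k := n.+2) c0.
  have u3 : 1 - ((N.+1 - 0) ^_ n.+2)%:R / N.+1%:R ^+ n.+2 @[N --> \oo] --> (0 : R).
    have := cvgB (cvg_cst (1 : R)) u2.
    by rewrite subr0 /pos_part max_r ?ler01 // expr1n subrr; apply.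
  rewrite -[spacing_cdf n x]addr0; apply: (cvgr_to_ge (cvgD u1 u3)).
  apply: nearW => N; rewrite -lee_fin -pE.
  apply: (@cdf_max_gap_le _ _ _ _ _ _ (a N)) => //; first exact: ltW.
  have /andP[_] := truncn_itv (xN N).
  by rewrite /a -!natr1; lra.
(* Lower bound: [a N + 1] is at most [x N.+1] once [x N.+1 >= 1]. *)
- pose a N := (Num.truncn (x * N.+1%:R)).-1.
  have ac : (a N)%:R / N.+1%:R @[N --> \oo] --> x.
    apply: (@close_to_ratio_cvg _ _ _ 2) => N.
    have /andP[] := truncn_itv (xN N).
    rewrite /a; case: (Num.truncn _) => [|k] /=; rewrite -!natr1; lra.
  have u1 := step_poly_ratio_cvg (n := n) ac.
  apply: (cvgr_to_le u1).
  have [M _ HM] : \forall N \near \oo, harmonic N < x.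
    by have /cvgr_lt := @cvg_harmonic R; apply.
  exists M => // N MN; rewrite -lee_fin -pE.
  apply: cdf_max_gap_ge => //.
  have := HM N MN; rewrite /= /harmonic -(ltr_pM2r (ltr0Sn R N)) mulVf ?pnatr_eq0 // => xN1.
  have /andP[h1 h2] := truncn_itv (xN N).
  rewrite /a prednK ?h1 // lt0n; apply/eqP => t0; rewrite t0 in h2; lra.
Qed.

(** * Beta integrals of truncated powers *)

(** The exponent is at least [2], which makes the corner at [0]
    differentiable: there the difference quotient is [pos_part h ^+ k.+1]. *)
Lemma is_derive_pos_part_expn (R : realType) k (u : R) :
  is_derive u (1 : R) (fun v => pos_part v ^+ k.+2) (k.+2%:R * pos_part u ^+ k.+1).
Proof.
have [u0|u0|->] := ltgtP u 0.
- have -> : pos_part u = 0 by rewrite /pos_part max_l // ltW.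
  rewrite expr0n /= mulr0.
  apply: (@near_eq_is_derive _ _ _ (cst 0)).
  have := @lt_nbhsl R u 0 u0; apply: filterS => v v0.
  by rewrite /pos_part max_l ?expr0n // ltW.
- have -> : pos_part u = u by rewrite /pos_part max_r // ltW.
  apply: (@near_eq_is_derive _ _ _ (fun v : R => v ^+ k.+2)).
    have := @lt_nbhsr R 0 u u0; apply: filterS => v v0.
    by rewrite /pos_part max_r // ltW.
  have := @is_deriveX R R id k.+2 u 1 1 (is_derive_id _ _).
  by rewrite exprfctE /= scaler1.
- have p0 : pos_part 0 = 0 :> R by rewrite /pos_part max_l.
  have H : h^-1 *: (pos_part (h *: 1 + 0) ^+ k.+2 - pos_part 0 ^+ k.+2)
      @[h --> (0 : R)^'] --> (0 : R).
    have c : pos_part h ^+ k.+1 @[h --> (0 : R)^'] --> (0 : R).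
      have := @continuous_pos_part R 0.
      move=> /(@cvg_comp _ _ _ _ (fun v : R => v ^+ k.+1) _ _ _)/(_ (@exprn_continuous _ _ _)).
      by rewrite p0 expr0n => c; apply: cvg_within_filter.
    apply: cvg_trans c; apply: near_eq_cvg; near=> h.
    have h0 : h != 0 by near: h; exact: nbhs_dnbhs_neq.
    rewrite p0 expr0n subr0 addr0 scaler1 /GRing.scale /= /pos_part.
    have [h0'|h0'] := leP 0 h; first by rewrite [in RHS]exprS mulKf.
    by rewrite !expr0n mulr0.
  rewrite p0 expr0n mulr0; apply: DeriveDef.
    by apply/cvg_ex; exists 0.
  exact: cvg_lim H.
Unshelve. all: by end_near.
Qed.

(** A primitive of [m x^(m-1) pos_part (1 - c x)^k], for positive [k],
    obtained by repeated integration by parts.  Lowering the power of [x] and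
    raising that of the truncated factor keeps every term differentiable at
    [1 / c], and makes the primitive vanish at [1] when [1 <= c]. *)
Fixpoint tail_primitive (R : realType) (c : R) (m k : nat) (x : R) : R :=
  if m is m'.+1 then
    m%:R / (c * k.+1%:R)
      * (tail_primitive c m' k.+1 x - x ^+ m' * pos_part (1 - c * x) ^+ k.+1)
  else 0.

Lemma is_derive_pos_part_affine (R : realType) (c : R) k (x : R) :
  is_derive x (1 : R) (fun y => pos_part (1 - c * y) ^+ k.+2)
    (- c * (k.+2%:R * pos_part (1 - c * x) ^+ k.+1)).
Proof.
have d1 : is_derive x (1 : R) (fun y : R => 1 - c * y) (- c).
  have h1 := is_derive_cst (1 : R) x (1 : R).
  have h2 := is_deriveZ c (is_derive_id x (1 : R)).
  have := is_deriveB h1 h2.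
  by rewrite sub0r scaler1.
have := @is_derive1_comp R _ (fun y => 1 - c * y) x _ _
  (is_derive_pos_part_expn k (1 - c * x)) d1.
by rewrite mulrC.
Qed.

Lemma continuous_pos_part_affine (R : realType) (c : R) k :
  continuous (fun x : R => pos_part (1 - c * x) ^+ k.+1).
Proof.
move=> x; have h : (1 - c * y) @[y --> x] --> 1 - c * x.
  by apply: cvgB; [exact: cvg_cst|apply: cvgMr; exact: cvg_id].
apply: (@cvg_comp _ _ _ (fun y : R => pos_part (1 - c * y)) (fun v : R => v ^+ k.+1)
  _ (nbhs (pos_part (1 - c * x)))); last exact: exprn_continuous.
exact: (cvg_comp _ _ h (@continuous_pos_part R _)).
Qed.

Lemma is_derive_tail_primitive (R : realType) (c : R) m k (x : R) : c != 0 ->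
  is_derive x (1 : R) (tail_primitive c m k.+1)
    (m%:R * x ^+ m.-1 * pos_part (1 - c * x) ^+ k.+1).
Proof.
move=> c0; elim: m k => [|m IH] k /=.
  by rewrite !mul0r; apply: is_derive_cst.
have dm : is_derive x (1 : R) (fun y : R => y ^+ m) (m%:R * x ^+ m.-1).
  have := @is_deriveX R R id m x 1 1 (is_derive_id _ _).
  by rewrite exprfctE /= scaler1.
have h := is_deriveZ (m.+1%:R / (c * k.+2%:R))
  (is_deriveB (IH k.+1) (is_deriveM dm (is_derive_pos_part_affine c k x))).
apply: (is_derive_eq h); rewrite /GRing.scale /=.
have k0 : k.+2%:R != 0 :> R by rewrite pnatr_eq0.
move: k0 c0; move: (k.+2%:R) => K K0 c0.
by field; rewrite K0 c0.
Qed.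

Lemma tail_primitive0 (R : realType) (c : R) m k : c != 0 ->
  tail_primitive c m.+1 k 0 = - (m.+1`!%:R * k`!%:R / (c ^+ m.+1 * (k + m.+1)`!%:R)).
Proof.
move=> c0; have f0 j : j`!%:R != 0 :> R by rewrite pnatr_eq0 -lt0n fact_gt0.
have n0 j : j.+1%:R != 0 :> R by rewrite pnatr_eq0.
have cm0 j : c ^+ j != 0 by rewrite expf_neq0.
elim: m k => [|m IH] k.
  rewrite /= sub0r expr0 mul1r mulr0 subr0 /pos_part max_r ?ler01 // expr1n.
  rewrite addn1 (factS k) natrM (_ : 1`! = 1%N) // expr1 mulrN mulr1; congr -%R.
  move: (f0 k) (n0 k); move: (k`!%:R) (k.+1%:R) => a b a0 b0.
  by field; rewrite c0 a0 b0.
have -> : tail_primitive c m.+2 k 0 = m.+2%:R / (c * k.+1%:R) *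
    (tail_primitive c m.+1 k.+1 0 - 0 ^+ m.+1 * pos_part (1 - c * 0) ^+ k.+1) by [].
rewrite IH (exprS (0 : R) m) !mul0r subr0 addSnnS (factS m.+1) (factS k) !natrM (exprS c m.+1).
move: (f0 k) (n0 k) (f0 (k + m.+2)%N) (cm0 m.+1).
move: (k`!%:R) (k.+1%:R) ((k + m.+2)`!%:R) (c ^+ m.+1) => a b e g a0 b0 e0 g0.
by field; rewrite ?c0 ?a0 ?b0 ?e0 ?g0.
Qed.

Lemma tail_primitive1 (R : realType) (c : R) m k : 1 <= c -> tail_primitive c m k 1 = 0.
Proof.
move=> c1; elim: m k => [//|m IH] k /=.
by rewrite IH /pos_part max_l ?expr0n /= ?mulr0 ?subrr ?mulr0 // mulr1 subr_le0.
Qed.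

(** One application of the fundamental theorem of calculus to the whole
    linear combination; each truncated power vanishes beyond [1 / j.+1], which
    is at most [1]. *)
Lemma integral_tail_sum (R : realType) m k N (s : nat -> R) :
  (\int[lebesgue_measure]_(x in `[0%R, 1%R])
     (m.+1%:R * x ^+ m * \sum_(j < N) s j * pos_part (1 - j.+1%:R * x) ^+ k.+1)%:E
  = (\sum_(j < N) s j
      * (m.+1`!%:R * k.+1`!%:R / (j.+1%:R ^+ m.+1 * (k.+1 + m.+1)`!%:R)))%:E)%E.
Proof.
pose F x := \sum_(j < N) s j * tail_primitive j.+1%:R m.+1 k.+1 x.
pose f x : R := m.+1%:R * x ^+ m * \sum_(j < N) s j * pos_part (1 - j.+1%:R * x) ^+ k.+1.
have dF x : is_derive x (1 : R) F (f x).
  have dj (j : 'I_N) : is_derive x (1 : R)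
      (fun y => s j * tail_primitive j.+1%:R m.+1 k.+1 y)
      (s j * (m.+1%:R * x ^+ m * pos_part (1 - j.+1%:R * x) ^+ k.+1)).
    have := is_deriveZ (s j) (@is_derive_tail_primitive R j.+1%:R m.+1 k x _).
    by apply; rewrite pnatr_eq0.
  have h := is_derive_sum dj.
  rewrite (_ : \sum_(i < N) _ = F) in h; last by apply/funext => y; rewrite fct_sumE.
  apply: (is_derive_eq h); rewrite /f mulr_sumr; apply: eq_bigr => j _; ring.
have cF : continuous F by move=> x; apply/differentiable_continuous/derivable1_diffP.
have cf : continuous f.
  move=> x; apply: cvgM; first by apply: cvgMr; exact: exprn_continuous.
  apply: cvg_big => [|j _]; first exact: add_continuous.
  apply: cvgMr; exact: continuous_pos_part_affine.
rewrite (@continuous_FTC2 _ f F) ?ltr01 //.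
- rewrite -EFinB /F -sumrB; congr EFin; apply: eq_bigr => j _.
  rewrite tail_primitive1 ?ler1n // mulr0 sub0r tail_primitive0 ?pnatr_eq0 //.
  by rewrite mulrN opprK.
- exact: continuous_subspaceT.
- split; first by move=> x _.
    by apply: cvg_at_right_filter; apply: cF.
  by apply: cvg_at_left_filter; apply: cF.
- by move=> x _; rewrite derive1E derive_val.
Qed.

(** * Moments *)

Lemma integral_exprn (R : realType) m (r : R) : 0 <= r ->
  (\int[lebesgue_measure]_(x in `]0%R, r[) (m.+1%:R * x ^+ m)%:E = (r ^+ m.+1)%:E)%E.
Proof.
rewrite le_eqVlt => /predU1P[<-|r0].
  by rewrite set_itv_ge ?bnd_simp ?ltxx // integral_set0 expr0n.
have cf : continuous (fun x : R => m.+1%:R * x ^+ m).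
  by move=> x; apply: cvgMr; exact: exprn_continuous.
have dF (x : R) : is_derive x (1 : R) (fun y => y ^+ m.+1) (m.+1%:R * x ^+ m).
  have := @is_deriveX R R id m.+1 x 1 1 (is_derive_id _ _).
  by rewrite exprfctE /= scaler1.
rewrite integral_itv_obnd_cbnd; last first.
  apply/measurable_EFinP/measurable_funTS; exact: continuous_measurable_fun.
rewrite integral_itv_bndo_bndc; last first.
  apply/measurable_EFinP/measurable_funTS; exact: continuous_measurable_fun.
rewrite (@continuous_FTC2 _ _ (fun y => y ^+ m.+1)) //.
- by rewrite expr0n sube0.
- exact: continuous_subspaceT.
- split; first by move=> x _.
    by apply: cvg_at_right_filter; apply: exprn_continuous.
  by apply: cvg_at_left_filter; apply: exprn_continuous.
- by move=> x _; rewrite derive1E derive_val.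
Qed.

(** Writes [D^(m+1)] as the integral of the derivative of [x^(m+1)] over
    [0 < x < D] and exchanges the integrals. *)
Lemma ge0_integral_exprn_tail (d : measure_display) (T : measurableType d) (R : realType)
    (P : probability T R) (D : T -> R) m :
  measurable_fun setT D -> (forall w, 0 <= D w) ->
  (\int[P]_w (D w ^+ m.+1)%:E
   = \int[lebesgue_measure]_(x in `]0%R, +oo[)
      ((m.+1%:R * x ^+ m)%:E * P [set w | (x < D w)%R]))%E.
Proof.
move=> mD D0.
pose E : set (T * measurableTypeR R) := [set p | (0 < p.2)%R && (p.2 < D p.1)%R].
pose g (p : T * measurableTypeR R) : \bar R := (m.+1%:R * p.2 ^+ m * \1_E p)%:E.
have mD1 : measurable_fun setT (fun p : T * measurableTypeR R => D p.1).
  by apply: measurableT_comp mD _; exact: measurable_fst.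
have mE : measurable E.
  have -> : E = (fun p : T * measurableTypeR R => (0 < p.2)%R && (p.2 < D p.1)%R) @^-1` [set true].
    by apply/seteqP; split.
  rewrite -[X in measurable X]setTI.
  apply: (measurable_and _ _) => //.
  - apply: measurable_fun_ltr => //; exact: measurable_snd.
  - apply: measurable_fun_ltr => //; exact: measurable_snd.
have mg : measurable_fun setT g.
  apply/measurable_EFinP; apply: measurable_funM; last exact: measurable_indic.
  apply: measurable_funM => //; apply: measurable_funX; exact: measurable_snd.
have g0 p : (0 <= g p)%E.
  rewrite /g lee_fin indicE; case: (asboolP (p \in E)); last first.
    by move=> /negP/negbTE ->; rewrite mulr0.
  move=> pE; rewrite pE mulr1; move: pE; rewrite inE => /andP[/ltW p0 _].
  by rewrite mulr_ge0 // exprn_ge0.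
transitivity (\int[P]_w \int[lebesgue_measure]_x g (w, x))%E.
  apply: eq_integral => w _; rewrite -integral_exprn // integral_mkcond.
  apply: eq_integral => x _; rewrite patchE /g indicE /=.
  have -> : ((w, x) \in E) = (x \in `]0%R, D w[%classic).
    by apply/idP/idP; rewrite !inE.
  by case: ifP; rewrite ?mulr1 ?mulr0.
rewrite fubini_tonelli // [RHS]integral_mkcond; apply: eq_integral => x _.
rewrite patchE; case: ifPn => [|x0].
  rewrite inE /= in_itv /= andbT => x0.
  have mx : measurable [set w | (x < D w)%R].
    rewrite (_ : [set w | _] = D @^-1` `]x, +oo[); last first.
      by apply/seteqP; split=> w; rewrite /= in_itv /= andbT.
    by rewrite -[X in measurable X]setTI; apply: mD.
  rewrite (eq_integral (fun w => ((m.+1%:R * x ^+ m)%:E * (\1_[set w | (x < D w)%R] w)%:E)%E)).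
    rewrite ge0_integralZl //.
    - by rewrite integral_indic ?setIT.
    - exact/measurable_EFinP/measurable_indic.
    - by rewrite lee_fin mulr_ge0 // exprn_ge0 // ltW.
  move=> w _; rewrite /g -EFinM !indicE; congr (_ * (nat_of_bool _)%:R)%:E.
  by apply/idP/idP; rewrite !inE /E /= x0.
apply: integral0_eq => w _; rewrite /g indicE memNset ?mulr0 //.
move=> /= /andP[x0' _]; move/negP: x0; apply.
by rewrite inE /= in_itv /= x0'.
Qed.

Definition spacing_tail (R : realType) (n : nat) (x : R) : R :=
  \sum_(j < n.+2) ((-1) ^+ j * 'C(n.+2, j.+1)%:R) * pos_part (1 - j.+1%:R * x) ^+ n.+1.

(** The term of index [0] of [spacing_cdf] is [1]. *)
Lemma spacing_tailE (R : realType) n (x : R) :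
  spacing_tail n x = 1 - spacing_cdf n x.
Proof.
rewrite /spacing_cdf big_ord_recl /= mul0r subr0 /pos_part max_r ?ler01 //.
rewrite expr1n bin0 !mulr1 expr0 opprD addNKr -sumrN; apply: eq_bigr => j _.
by rewrite /bump leq0n add1n (exprS _ j) mulN1r !mulNr opprK.
Qed.

Lemma spacing_tail_ge1 (R : realType) n (x : R) : 1 <= x -> spacing_tail n x = 0.
Proof.
move=> x1; rewrite /spacing_tail big1 // => j _.
rewrite /pos_part max_l ?expr0n ?mulr0 // subr_le0.
by rewrite (le_trans x1) // ler_peMl ?ler1n // (le_trans ler01).
Qed.

Lemma max_gap_tail (d : measure_display) (T : measurableType d) (R : realType)
    (P : probability T R) (n : nat) (X : 'I_n.+2 -> {RV P >-> R}) (x : R) :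
  mutually_independent X -> (forall i, uniform01 (X i)) -> 0 < x ->
  P [set w | (x < max_gap (fun i => X i w))%R] = (spacing_tail n x)%:E.
Proof.
move=> indep unif x0.
have -> : [set w | (x < max_gap (fun i => X i w))%R]
    = ~` [set w | (max_gap (fun i => X i w) <= x)%R].
  by apply/seteqP; split=> w /=; rewrite ltNge => /negP.
rewrite probability_setC; last exact: measurable_max_gap_le.
by rewrite cdf_max_gap // spacing_tailE EFinB.
Qed.

Lemma max_gap_single (R : realType) (x : 'I_1 -> R) : max_gap x = 1.
Proof. by rewrite /max_gap big_ord_recl big_ord0 /circle_gap /= addrK max_l. Qed.

(** The tail of the law vanishes beyond [1], so only the unit interval
    contributes to the integral of the tail. *)
Lemma expectation_max_gap_exp (d : measure_display) (T : measurableType d) (R : realType)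
    (P : probability T R) (n m : nat) (X : 'I_n.+2 -> {RV P >-> R}) :
  mutually_independent X -> (forall i, uniform01 (X i)) ->
  'E_P[(fun w => max_gap (fun i => X i w) ^+ m.+1)%R]%E =
  (n.+1`!%:R / (n.+1 + m.+1)`!%:R * (m.+1`!%:R * alt_binom_sum R n.+2 m.+1))%:E.
Proof.
move=> indep unif; rewrite unlock ge0_integral_exprn_tail //; first last.
- by move=> w; apply: max_gap_ge0.
- exact: measurable_max_gap.
pose f (x : R) : R := m.+1%:R * x ^+ m * spacing_tail n x.
have cf : continuous f.
  move=> x; apply: cvgM; first by apply: cvgMr; exact: exprn_continuous.
  apply: cvg_big => [|j _]; first exact: add_continuous.
  apply: cvgMr; exact: continuous_pos_part_affine.
transitivity (\int[lebesgue_measure]_(x in `]0%R, 1%R]) (f x)%:E)%E.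
  rewrite integral_mkcond [RHS]integral_mkcond; apply: eq_integral => x _.
  rewrite !patchE; have [x0|x0] := ltP 0 x; last first.
    by rewrite !memNset //= in_itv /= ltNge x0.
  rewrite mem_set /= ?in_itv /= ?x0 // max_gap_tail // -EFinM -/(f x).
  case: ifPn => // x1; rewrite /f spacing_tail_ge1 ?mulr0 //.
  rewrite leNgt; apply/negP => x1'; move/negP: x1; apply.
  by rewrite inE /= in_itv /= x0 ltW.
rewrite integral_itv_obnd_cbnd; last first.
  apply/measurable_EFinP/measurable_funTS; exact: continuous_measurable_fun.
rewrite (integral_tail_sum m n n.+2 (fun j => (-1) ^+ j * 'C(n.+2, j.+1)%:R)).
congr EFin.
rewrite /alt_binom_sum !mulr_sumr; apply: eq_bigr => j _.
by rewrite invfM; ring.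
Qed.

(* The exponent r_k is (r i : nat) with k = i.+1; the constraint forces
   r_k <= m, so r ranges over functions into 'I_m.+1. *)
Theorem theorem1 (d : measure_display) (T : measurableType d) (R : realType)
    (P : probability T R) (n m : nat) (X : 'I_n -> {RV P >-> R}) :
  (0 < n)%N -> (0 < m)%N ->
  mutually_independent X ->
  (forall i, uniform01 (X i)) ->
  'E_P[(fun w => max_gap (fun i => X i w) ^+ m)%R]%E =
  ((n - 1)`!%:R / (n + m - 1)`!%:R *
   \sum_(r : {ffun 'I_m -> 'I_m.+1} | (\sum_(i < m) i.+1 * r i)%N == m)
     (m`!%:R / \prod_(i < m) ((r i)`!%:R * i.+1%:R ^+ r i)
      * \prod_(i < m) harmonic_number R n i.+1 ^+ r i))%:E.
Proof.
case: n X => [//|n] X _ m0 indep unif.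
rewrite partition_sum_harmonic addSn !subSS !subn0.
case: n X indep unif => [|n] X indep unif.
  have -> : (fun w => max_gap (fun i => X i w) ^+ m) = cst 1.
    by apply/funext => w; rewrite max_gap_single expr1n.
  rewrite expectation_cst; congr EFin.
  rewrite add0n /alt_binom_sum big_ord1 binn expr1n divr1 !mulr1 div1r mulVf //.
by case: m m0 => // m _; rewrite expectation_max_gap_exp.
Qed.
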